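(* Let $\Lambda=(\lambda_n)_{n\in\mathbb{N}^*}$ be a sequence of positive real numbers which is ultimately strictly increasing and satisfies $\lim_{n\to\infty}\lambda_n=+\infty$. Assume that there exist $\ell>0$ and a sequence of real numbers $(\psi_n)_{n\in\mathbb{N}^*}$ such that $\lambda_n=\ell n+\psi_n$ for all $n$. Suppose that either (i) $(\psi_n)_{n\in\mathbb{N}^*}$ is ultimately non-decreasing, or (ii) $\kappa:=\liminf_{n\to\infty}\left|\ell+\frac{\psi_n}{n}\right|>0$ and $\sum_{n}\frac{|\psi_n|}{n^2}<+\infty$. Then $$b(\Lambda)\le\frac{1}{\ell}.$$ Moreover, in both cases, $\alpha:=\liminf_{n\to\infty}\frac{\psi_n}{n}\ge 0$. In particular, if $\alpha=0$, then $$b(\Lambda)=\overline d(\Lambda)=\frac{1}{\ell}.$$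
   Context: $\mathbb{N}^*=\{1,2,3,\dots\}$. For a sequence $\Lambda=(\lambda_n)_{n\in\mathbb{N}^*}$ of positive real numbers, ultimately strictly increasing, with $\lambda_n\to+\infty$: (1) The counting function is $F_\Lambda(t)=\#\{k\in\mathbb{N}^*:\lambda_k\le t\}$ for $t>0$, and $F_\Lambda(0)=0$. The upper asymptotic density of $\Lambda$ is $\overline d(\Lambda)=\limsup_{n\to\infty}F_\Lambda(n)/n\in[0,+\infty]$. (2) The Beurling-Malliavin density $b(\Lambda)\in[0,+\infty]$ is the infimum of the numbers $a\ge 0$ for which there exists a sequence $(n_k)_{k\in\mathbb{N}^*}$ of distinct positive integers such that $\sum_{k=1}^\infty\left|\frac{1}{\lambda_k}-\frac{a}{n_k}\right|<\infty$; if no such $a$ exists, $b(\Lambda)=+\infty$. *)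

(* Defs.v *)
From HB Require Import structures.
From mathcomp Require Import all_boot all_order all_algebra.
From mathcomp Require Import all_classical all_reals all_analysis.

Set Implicit Arguments.
Unset Strict Implicit.
Unset Printing Implicit Defensive.

Import Order.TTheory GRing.Theory Num.Theory.
Import numFieldNormedType.Exports.

Local Open Scope classical_set_scope.
Local Open Scope ring_scope.

(* Sequences indexed by {1, 2, 3, ...} are represented by functions on nat
   whose value at 0 is never used: indices are restricted to be positive, or
   the notion only depends on the behaviour at infinity. *)

Definition ultimately_increasing (R : realType) (u : R^nat) : Prop :=
  \forall n \near \oo, u n < u n.+1.

Definition ultimately_nondecreasing (R : realType) (u : R^nat) : Prop :=
  \forall n \near \oo, u n <= u n.+1.

(* [counting] is the cardinality with values in \bar R, equal to +oo on
   infinite sets. *)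
Definition counting_function (R : realType) (lambda : R^nat) (t : R) : \bar R :=
  if 0 < t then counting [set k : nat | (0 < k)%N /\ lambda k <= t] else 0%E.

Definition upper_asymptotic_density (R : realType) (lambda : R^nat) : \bar R :=
  limn_esup (fun n : nat =>
    counting_function lambda n%:R * (n%:R^-1)%:E)%E.

(* The infimum is taken in \bar R, where that of the empty set is +oo. *)
Definition beurling_malliavin_density (R : realType) (lambda : R^nat) : \bar R :=
  ereal_inf (EFin @` [set a : R | 0 <= a /\
    exists m : nat -> nat,
      [/\ forall k, (0 < k)%N -> (0 < m k)%N,
          {in [set k | (0 < k)%N] &, injective m} &
          (\sum_(1 <= k <oo) (`|(lambda k)^-1 - a / (m k)%:R| : R)%:E < +oo)%E]]).

(* Main.v *)
Require Import Defs.
From mathcomp Require Import all_boot all_order all_algebra.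
From mathcomp Require Import finmap lra ring.
From mathcomp Require Import all_classical all_reals all_analysis.
Import Order.TTheory GRing.Theory Num.Theory.
Import numFieldNormedType.Exports.
Local Open Scope classical_set_scope.
Local Open Scope ring_scope.

(** The bound b(Lambda) <= 1/ell comes from exhibiting integers m_k >= k such
that ell * m_k approximates lambda_k: when lambda_k is at least a multiple of
k, the difference 1/lambda_k - 1/(ell m_k) is at most a constant times
|lambda_k - ell m_k| / k^2, so it is enough that these last terms are summable
(beurling_malliavin_density_le_inv).  If psi is ultimately non-decreasing, k
plus the integer part of (psi_k - psi_N) / ell is strictly increasing and keeps
lambda_k - ell m_k bounded; if |psi_k| / k^2 is summable, m_k = k works.

Two of the other steps rest on one remark: if sum u_k converges, then for given
c, d > 0 and all large n there are fewer than d n indices k with u_k >= c / n,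
since d n such indices would carry a mass close to c d outside any fixed initial
segment (nneseries_few_large_terms).

- In the summable case, if psi_n < - e n for some large n, then, lambda being
  ultimately non-decreasing, psi stays below - e k / 2 on a block of indices k
  ending at n whose length is proportional to n; hence alpha >= 0.  For a
  non-decreasing psi this is immediate, psi being bounded below.

- The upper asymptotic density is at most b(Lambda), for every positive
  sequence.  Let a be admissible with integers m_k.  Among the k with
  lambda_k <= n, at most b n satisfy m_k <= b n, because the m_k are distinct;
  if b > a, each of the others contributes at least (1 - a/b) / n to the
  convergent series, so there are o(n) of them.

Finally, if alpha = 0 then lambda_n < r n for infinitely many n, for every
r > ell.  Apart from finitely many, the first n terms are then below r n, so
the upper asymptotic density is at least 1/ell, and
1/ell <= d(Lambda) <= b(Lambda) <= 1/ell. *)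

(** * Upper and lower limits of sequences *)

Lemma limn_esup_lt_near (R : realType) (u : (\bar R)^nat) (x : \bar R) :
  (limn_esup u < x)%E -> \forall n \near \oo, (u n < x)%E.
Proof.
rewrite /limn_esup limf_esupE => /ereal_inf_lt[_ [V FV <-] hx].
by apply: filterS FV => n Vn; apply: le_lt_trans hx; apply: ereal_sup_ubound; exists n.
Qed.

Lemma near_limn_esup_le (R : realType) (u : (\bar R)^nat) (x : \bar R) :
  (\forall n \near \oo, (u n <= x)%E) -> (limn_esup u <= x)%E.
Proof.
move=> ux; rewrite /limn_esup limf_esupE; apply: ge_ereal_inf.
exists (ereal_sup (u @` [set n | (u n <= x)%E])); first by exists [set n | (u n <= x)%E].
by apply/ereal_supP => _ [n /= un <-].
Qed.

Lemma limn_einf_gt_near (R : realType) (u : (\bar R)^nat) (x : \bar R) :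
  (x < limn_einf u)%E -> \forall n \near \oo, (x < u n)%E.
Proof.
rewrite /limn_einf lteNr => /limn_esup_lt_near.
by apply: filterS => n; rewrite lteN2.
Qed.

Lemma near_limn_einf_ge (R : realType) (u : (\bar R)^nat) (x : \bar R) :
  (\forall n \near \oo, (x <= u n)%E) -> (x <= limn_einf u)%E.
Proof.
move=> ux; rewrite /limn_einf leeNr; apply: near_limn_esup_le.
by apply: filterS ux => n; rewrite leeN2.
Qed.

Lemma near_nondecreasing (R : realType) (u : R^nat) :
  ultimately_nondecreasing u ->
  \forall N \near \oo, forall k n, (N <= k)%N -> (k <= n)%N -> u k <= u n.
Proof.
move=> [M _ uM]; exists M => // N /= MN k n Nk; elim: n => [|n IHn].
  by rewrite leqn0 => /eqP ->.
rewrite leq_eqVlt => /predU1P[-> //|]; rewrite ltnS => kn.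
exact: le_trans (IHn kn) (uM _ (leq_trans MN (leq_trans Nk kn))).
Qed.

Lemma ultimately_increasingW (R : realType) (u : R^nat) :
  ultimately_increasing u -> ultimately_nondecreasing u.
Proof. by apply: filterS => n; exact: ltW. Qed.

(** * Series with nonnegative terms *)

Lemma nneseries_lty_bounded (R : realType) (u : R^nat) :
  (forall k, 0 <= u k) ->
  (\sum_(1 <= k <oo) (u k)%:E < +oo)%E <->
  exists B : R, forall n, \sum_(1 <= k < n) u k <= B.
Proof.
move=> u0; have u0E k : (1 <= k)%N -> true -> (0 <= (u k)%:E)%E by rewrite lee_fin.
split=> [uoo|[B uB]].
  exists (fine (\sum_(1 <= k <oo) (u k)%:E)) => n.
  rewrite -lee_fin fineK; last first.
    by rewrite ge0_fin_numE//; apply: nneseries_ge0 => k _ _; rewrite lee_fin.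
  by rewrite -sumEFin; apply: nneseries_lim_ge.
apply: (@le_lt_trans _ _ B%:E); last exact: ltry.
apply: lime_le; first exact: is_cvg_nneseries.
by apply: nearW => n; rewrite sumEFin lee_fin.
Qed.

Lemma nneseries_tail_lt (R : realType) (u : R^nat) (e : R) :
  (forall k, 0 <= u k) -> (\sum_(1 <= k <oo) (u k)%:E < +oo)%E -> 0 < e ->
  exists M, forall n, \sum_(M.+1 <= k < n) u k < e.
Proof.
move=> u0 /(nneseries_lty_bounded _ _ u0)[B uB] e0.
pose S := [set \sum_(1 <= k < n) u k | n in [set: nat]].
have supS : has_sup S.
  by split; [exists (\sum_(1 <= k < 0) u k); exists 0%N | exists B => _ [n _ <-]].
have [_ [M _ <-] hM] := sup_adherent e0 supS.
exists M => n; have [nM|Mn] := leqP n M.+1; first by rewrite big_geq.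
have : \sum_(1 <= k < n) u k <= sup S by apply: sup_ubound; [case: supS|exists n].
rewrite (@big_cat_nat _ _ _ M.+1)//=; last exact: ltnW.
suff : \sum_(1 <= k < M) u k <= \sum_(1 <= k < M.+1) u k by lra.
case: M {hM Mn} => [|M]; first by rewrite !big_geq.
by rewrite [leRHS]big_nat_recr//= lerDl.
Qed.

Lemma nneseries_lty_near_le (R : realType) (u v : R^nat) :
  (forall k, 0 <= u k) -> (forall k, 0 <= v k) ->
  (\forall k \near \oo, v k <= u k) ->
  (\sum_(1 <= k <oo) (u k)%:E < +oo)%E -> (\sum_(1 <= k <oo) (v k)%:E < +oo)%E.
Proof.
move=> u0 v0 [N _ vu] /(nneseries_lty_bounded _ _ u0)[B uB].
apply/nneseries_lty_bounded => //; exists (\sum_(1 <= k < N.+1) v k + B) => n.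
have sum0 (w : R^nat) a b : (forall k, 0 <= w k) -> 0 <= \sum_(a <= k < b) w k.
  by move=> w0; apply: sumr_ge0.
have [nN|Nn] := leqP N.+1 n; last first.
  rewrite -[leLHS]addr0 lerD//; last by apply: le_trans (uB 0%N); exact: sum0.
  have [n0|n0] := leqP n 1; first by rewrite big_geq//; exact: sum0.
  rewrite (@big_cat_nat _ _ _ n 1 N.+1)//=; [|exact: ltnW|exact: ltnW].
  by rewrite lerDl; exact: sum0.
rewrite (@big_cat_nat _ _ _ N.+1 1 n)//= lerD2l; apply: le_trans (uB n).
rewrite (@big_cat_nat _ _ _ N.+1 1 n)//=; apply: ler_wpDl; first exact: sum0.
by apply: ler_sum_nat => k /andP[Nk _]; apply: vu => /=; exact: ltnW.
Qed.

Lemma nneseries_ltyZ (R : realType) (u : R^nat) (c : R) :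
  0 <= c -> (forall k, 0 <= u k) ->
  (\sum_(1 <= k <oo) (u k)%:E < +oo)%E ->
  (\sum_(1 <= k <oo) (c * u k)%:E < +oo)%E.
Proof.
move=> c0 u0 /(nneseries_lty_bounded _ _ u0)[B uB].
apply/nneseries_lty_bounded; first by move=> k; rewrite mulr_ge0.
by exists (c * B) => n; rewrite -mulr_sumr ler_wpM2l.
Qed.

(** Comparison with the telescoping series of 1/(k-1) - 1/k bounds the partial
sums by 2 - 1/n. *)
Lemma nneseries_inv_sqr_lty (R : realType) :
  (\sum_(1 <= k <oo) ((k%:R ^+ 2)^-1 : R)%:E < +oo)%E.
Proof.
apply/nneseries_lty_bounded; first by move=> k; rewrite invr_ge0 sqr_ge0.
exists 2 => n.
suff H m : \sum_(1 <= k < m.+2) ((k%:R ^+ 2)^-1 : R) <= 2 - m.+1%:R^-1.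
  case: n => [|[|n]]; try by rewrite big_geq.
  by apply: le_trans (H n) _; rewrite lerBlDr lerDl invr_ge0.
elim: m => [|m IHm]; first by rewrite big_nat1 expr1n invr1; lra.
rewrite big_nat_recr//=; apply: le_trans (lerD IHm (lexx _)) _.
have m0 : 0 <= m%:R :> R by [].
rewrite -subr_ge0 -[m.+2]addn2 -[m.+1]addn1 !natrD.
set x : R := m%:R in m0 *.
have -> : 2 - (x + 2)^-1 - (2 - (x + 1)^-1 + ((x + 2) ^+ 2)^-1) =
   ((x + 1) * (x + 2) ^+ 2)^-1.
  by field; apply/andP; split; lra.
by rewrite invr_ge0 mulr_ge0// ?sqr_ge0//; lra.
Qed.

(** d * n indices at which the terms are at least c / n carry a mass c * d.
When n is large, dropping those among the indices up to M, where M makes the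
tail smaller than c * d / 2, leaves at least half of this mass in the tail. *)
Lemma nneseries_few_large_terms (R : realType) (u : R^nat) (c d : R) :
  (forall k, 0 <= u k) -> (\sum_(1 <= k <oo) (u k)%:E < +oo)%E ->
  0 < c -> 0 < d ->
  \forall n \near \oo, forall s : seq nat, uniq s ->
    (forall k, k \in s -> c / n%:R <= u k) -> (size s)%:R < d * n%:R.
Proof.
move=> u0 uoo c0 d0.
have e0 : 0 < c * d / 2 by rewrite divr_gt0// mulr_gt0.
have [M tailM] := nneseries_tail_lt _ _ _ u0 uoo e0.
near=> n => s us su.
have n0 : 0 < n%:R :> R.
  by rewrite ltr0n; near: n; exact: nbhs_infty_gt.
have nM : M.+1%:R <= d / 2 * n%:R.
  rewrite mulrC -ler_pdivrMr ?divr_gt0//; near: n; exact: nbhs_infty_ger.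
rewrite ltNge; apply/negP => ns.
pose t := [seq k <- s | (M < k)%N].
have st : (size s <= size t + M.+1)%N.
  rewrite -(count_predC [pred k | (M < k)%N] s) -size_filter leq_add2l -size_filter.
  rewrite -[X in (_ <= X)%N](size_iota 0).
  apply: uniq_leq_size; first exact: filter_uniq.
  by move=> k; rewrite mem_filter inE mem_iota -leqNgt => /andP[].
have tsum : (size t)%:R * (c / n%:R) <= \sum_(k <- t) u k.
  rewrite -sum1_size natr_sum mulr_suml big_seq [leRHS]big_seq.
  by apply: ler_sum => k; rewrite mem_filter mul1r => /andP[_ /su].
pose P := (\max_(k <- t) k).+1.
have tP : \sum_(k <- t) u k <= \sum_(M.+1 <= k < P) u k.
  have -> : \sum_(k <- t) u k = \sum_(M.+1 <= k < P | k \in t) u k.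
    rewrite -[RHS]big_filter; apply: perm_big; apply: uniq_perm.
    - exact: filter_uniq.
    - exact/filter_uniq/iota_uniq.
    move=> k; rewrite [RHS]mem_filter mem_index_iota.
    apply/idP/andP => [kt|[]//]; split=> //.
    by rewrite ltnS (leq_bigmax_seq _ kt)// andbT; move: kt; rewrite mem_filter => /andP[].
  by rewrite [leRHS](bigID (mem t))/= lerDl sumr_ge0.
have := le_lt_trans tsum (le_lt_trans tP (tailM P)).
rewrite ltNge => /negP; apply; rewrite mulrA ler_pdivlMr//.
have : (size s)%:R <= (size t)%:R + M.+1%:R :> R by rewrite -natrD ler_nat.
move: ns nM; nra.
Unshelve. all: by end_near. Qed.

(** * Cardinalities through duplicate-free sequences *)

Lemma counting_le (R : realType) (T : choiceType) (A : set T) (x : R) :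
  (forall s : seq T, uniq s -> (forall k, k \in s -> A k) -> (size s)%:R <= x) ->
  (counting A <= x%:E)%E.
Proof.
move=> sx; rewrite /counting; case: asboolP => [finA|infA].
  rewrite lee_fin; apply: sx => [|k]; first exact: fset_uniq.
  by rewrite in_fset_set// inE.
have [B BA xB] := infinite_set_fset (Num.truncn x).+1 infA.
have := sx B (fset_uniq B) BA.
rewrite leNgt (lt_le_trans (truncnS_gt x))//.
by rewrite ler_nat.
Qed.

Lemma size_le_counting (R : realType) (T : choiceType) (A : set T) (s : seq T) :
  uniq s -> (forall k, k \in s -> A k) -> ((size s)%:R%:E <= @counting T R A)%E.
Proof.
move=> us sA; rewrite /counting; case: asboolP => [finA|_]; last exact: leey.
rewrite lee_fin ler_nat; apply: uniq_leq_size => // k /sA Ak.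
by rewrite in_fset_set// inE.
Qed.

(** * The two densities *)

(** The m_k being distinct, at most b * n of the indices k with lambda_k <= n
have m_k <= b * n.  If a < b, the others are few, as they contribute at least
(1 - a / b) / n each to the convergent series of an admissible a. *)
Lemma upper_asymptotic_density_le_beurling_malliavin (R : realType)
    (lambda : R^nat) :
  (forall n, (0 < n)%N -> 0 < lambda n) ->
  (upper_asymptotic_density lambda <= beurling_malliavin_density lambda)%E.
Proof.
move=> lambda_gt0; apply/ereal_infP => _ [a [a0 [m [m_gt0 m_inj m_sum]]] <-].
apply/lee_addgt0Pr => e e0; apply: near_limn_esup_le.
pose b := a + e / 2; have b0 : 0 < b by rewrite ltr_wpDl// divr_gt0.
have c0 : 0 < 1 - a / b by rewrite subr_gt0 ltr_pdivrMr// mul1r /b; lra.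
have e20 : 0 < e / 2 by rewrite divr_gt0.
have u0 k : 0 <= `|(lambda k)^-1 - a / (m k)%:R| by [].
near=> n.
have few : forall s : seq nat, uniq s ->
    (forall k, k \in s -> (1 - a / b) / n%:R <= `|(lambda k)^-1 - a / (m k)%:R|) ->
    (size s)%:R < e / 2 * n%:R.
  by near: n; exact: nneseries_few_large_terms.
have n0 : 0 < n%:R :> R by rewrite ltr0n; near: n; exact: nbhs_infty_gt.
rewrite /counting_function n0 lee_pdivrMr// -EFinM.
apply: counting_le => s us sn.
pose p := [pred k | b * n%:R < (m k)%:R].
have p_few : (size (seq.filter p s))%:R < e / 2 * n%:R.
  apply: few; first exact: filter_uniq.
  move=> k; rewrite mem_filter => /andP[/= bm /sn[k0 kn]].
  apply: le_trans (ler_norm _); rewrite mulrBl mul1r; apply: lerB.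
    by rewrite lef_pV2// posrE; exact: lambda_gt0.
  rewrite -mulrA -invfM ler_wpM2l// lef_pV2 ?posrE ?mulr_gt0 ?(ltr0n _ (m k)) ?m_gt0//.
  exact: ltW.
have pC_few : (size (seq.filter (predC p) s))%:R <= b * n%:R.
  have bn0 : 0 <= b * n%:R by rewrite mulr_ge0// ltW.
  rewrite -(size_map m) -truncn_ge_nat// -(size_iota 1 (Num.truncn _)).
  apply: uniq_leq_size.
    rewrite map_inj_in_uniq ?filter_uniq// => i j.
    rewrite !mem_filter => /andP[_ /sn[i0 _]] /andP[_ /sn[j0 _]].
    by apply: m_inj; rewrite inE.
  move=> j /mapP[i + ->]; rewrite mem_filter /= -leNgt => /andP[mb /sn[i0 _]].
  by rewrite mem_iota m_gt0//= add1n ltnS truncn_ge_nat.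
have -> : (size s)%:R = (size (seq.filter p s))%:R + (size (seq.filter (predC p) s))%:R :> R.
  by rewrite -natrD !size_filter count_predC.

by move: p_few pC_few; rewrite /b; lra.
Unshelve. all: by end_near. Qed.

(** If lambda_n < r * n for some large n, then, lambda being ultimately
increasing, about n terms are below r * n, whence a counting ratio close to
1 / r; this happens for infinitely many n as soon as r > ell. *)
Lemma inv_le_upper_asymptotic_density (R : realType) (lambda : R^nat) (ell : R) :
  ultimately_increasing lambda -> 0 < ell ->
  (limn_einf (fun n => (lambda n / n%:R)%:E) <= ell%:E)%E ->
  ((ell^-1)%:E <= upper_asymptotic_density lambda)%E.
Proof.
move=> lambda_incr ell0 einf_le; apply/lee_subgt0Pr => e e0.
rewrite -EFinB leNgt; apply/negP; set D := ell^-1 - e => dens_lt.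
have D_ell : D * ell < 1 by rewrite -ltr_pdivlMr// mul1r /D ltrBlDr ltrDl.
have [T _ dens_ltD] := limn_esup_lt_near _ _ _ dens_lt.
have counting_lt t : (T < t)%N ->
    (counting [set k | (0 < k)%N /\ (lambda k <= t%:R)%R] < (D * t%:R)%:E)%E.
  move=> Tt; have t0 : 0 < t%:R :> R by rewrite ltr0n (leq_ltn_trans _ Tt).
  have /= := dens_ltD _ (ltnW Tt).
  by rewrite /counting_function t0 lte_pdivrMr// -EFinM.
have D0 : 0 < D.
  have := counting_lt T.+1 (ltnSn T).
  move=> /(le_lt_trans (size_le_counting R _ _ [::] isT (fun k kn => False_ind _ (notF kn)))).
  by rewrite lte_fin pmulr_lgt0.
(* D * ell < 1 leaves room for ell < r with D * r < 1: if lambda_n < r * n, the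
   n - N terms with indices in (N, n] are below t, which is about r * n, and
   n - N exceeds D * t for large n. *)
pose r := (ell + D^-1) / 2.
have DD : D * D^-1 = 1 by rewrite divff ?gt_eqF.
have ell_lt_r : ell < r.
  have : ell < D^-1 by rewrite -[D^-1]mul1r ltr_pdivlMr// mulrC.
  by rewrite /r; lra.
have r0 : 0 < r by exact: lt_trans ell_lt_r.
have Dr : D * r < 1 by rewrite /r mulrA mulrDr DD; lra.
have [N _ lambda_mono] := near_nondecreasing _ _ (ultimately_increasingW _ _ lambda_incr).
suff : (r%:E <= ell%:E)%E by rewrite lee_fin leNgt ell_lt_r.
apply: le_trans einf_le; apply: near_limn_einf_ge; near=> n.
have n0 : 0 < n%:R :> R by rewrite ltr0n; near: n; exact: nbhs_infty_gt.
have Nn : (N <= n)%N by near: n; exact: nbhs_infty_ge.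
rewrite lee_fin ler_pdivlMr// leNgt; apply/negP => lambda_lt.
pose t := (Num.truncn (r * n%:R)).+1.
have rn0 : 0 <= r * n%:R by rewrite mulr_ge0// ltW.
have t_gt : r * n%:R < t%:R by exact: truncnS_gt.
have t_le : t%:R <= r * n%:R + 1 by rewrite /t -natr1 lerD2r truncn_le.
have Tt : (T < t)%N.
  rewrite ltnS truncn_ge_nat// mulrC -ler_pdivrMr//.
  by near: n; exact: nbhs_infty_ger.
have := counting_lt t Tt; rewrite ltNge => /negP; apply.
apply: le_trans (size_le_counting R _ _ (iota N.+1 (n - N)) (iota_uniq _ _) _).
  rewrite size_iota lee_fin natrB//.
  have : (N%:R + D) / (1 - D * r) <= n%:R by near: n; exact: nbhs_infty_ger.
  rewrite ler_pdivrMr ?subr_gt0//; move: t_le D0; nra.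
move=> k; rewrite mem_iota => /andP[Nk kn]; split; first by exact: leq_ltn_trans Nk.
apply: ltW; apply: le_lt_trans t_gt; apply: le_trans (ltW lambda_lt).
apply: (lambda_mono N) => //=; first exact: ltnW.
by move: kn; rewrite addSn ltnS subnKC.
Unshelve. all: by end_near. Qed.

(** The integers m_k witness that 1 / ell is admissible, because
1/lambda_k - 1/(ell m_k) = (ell m_k - lambda_k) / (lambda_k ell m_k), where the
denominator is at least c * ell * k ^ 2. *)
Lemma beurling_malliavin_density_le_inv (R : realType) (lambda : R^nat)
    (ell c : R) (m : nat -> nat) :
  0 < ell -> 0 < c -> (\forall k \near \oo, c * k%:R <= lambda k) ->
  {homo m : i j / (i < j)%N} -> (forall k, (k <= m k)%N) ->
  (\sum_(1 <= k <oo) (`|lambda k - ell * (m k)%:R| / k%:R ^+ 2)%:E < +oo)%E ->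
  (beurling_malliavin_density lambda <= (ell^-1)%:E)%E.
Proof.
move=> ell0 c0 lambda_ge m_incr m_ge m_sum; apply: ereal_inf_lbound.
exists ell^-1 => //; split; first by rewrite invr_ge0 ltW.
exists m; split.
- by move=> k k0; exact: leq_trans (m_ge k).
- move=> i j _ _ mij; case: (ltngtP i j) => // /m_incr; rewrite mij ltnn//.
have u0 k : 0 <= `|lambda k - ell * (m k)%:R| / k%:R ^+ 2.
  by rewrite divr_ge0// sqr_ge0.
apply: (@nneseries_lty_near_le _
  (fun k => (c * ell)^-1 * (`|lambda k - ell * (m k)%:R| / k%:R ^+ 2))) => //.
- by move=> k; rewrite mulr_ge0// invr_ge0 mulr_ge0// ltW.
- near=> k; rewrite /=.
  have k0 : 0 < k%:R :> R by rewrite ltr0n; near: k; exact: nbhs_infty_gt.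
  have ck : c * k%:R <= lambda k by near: k.
  have lk0 : 0 < lambda k by apply: lt_le_trans ck; exact: mulr_gt0.
  have mk : k%:R <= (m k)%:R :> R by rewrite ler_nat.
  have mk0 : 0 < (m k)%:R :> R by exact: lt_le_trans mk.
  have -> : (lambda k)^-1 - ell^-1 / (m k)%:R =
      (ell * (m k)%:R - lambda k) / (lambda k * (ell * (m k)%:R)).
    by field; rewrite !gt_eqF.
  rewrite normrM distrC normfV (gtr0_norm (mulr_gt0 lk0 (mulr_gt0 ell0 mk0))).
  rewrite [leRHS]mulrCA -invfM ler_wpM2l// lef_pV2 ?posrE ?mulr_gt0 ?exprn_gt0//.
  have -> : c * ell * k%:R ^+ 2 = (c * k%:R) * (ell * k%:R) by ring.
  by apply: ler_pM => //; rewrite ?mulr_ge0 ?ler_wpM2l// ltW.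
- by apply: nneseries_ltyZ => //; rewrite invr_ge0 mulr_ge0// ltW.
Unshelve. all: by end_near. Qed.

(** * Perturbed arithmetic progressions *)

Lemma limn_einf_ratio_ge0 (R : realType) (psi : R^nat) :
  (forall e : R, 0 < e -> \forall n \near \oo, - (e * n%:R) <= psi n) ->
  (0 <= limn_einf (fun n => (psi n / n%:R)%:E))%E.
Proof.
move=> psi_ge; apply/lee_subgt0Pr => e e0; rewrite sub0e -EFinN.
apply: near_limn_einf_ge; near=> n.
have n0 : 0 < n%:R :> R by rewrite ltr0n; near: n; exact: nbhs_infty_gt.
rewrite lee_fin ler_pdivlMr// mulNr.
by near: n; exact: psi_ge.
Unshelve. all: by end_near. Qed.

(** Subtracting psi_N from psi_k before taking the integer part keeps it
nonnegative, so that m_k >= k, while monotonicity of psi makes m strictly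
increasing; lambda_k - ell * m_k then lies within ell of psi_N. *)
Lemma beurling_malliavin_density_le_inv_nondecreasing (R : realType)
    (lambda psi : R^nat) (ell : R) :
  0 < ell -> (forall n, (0 < n)%N -> lambda n = ell * n%:R + psi n) ->
  ultimately_nondecreasing psi ->
  (beurling_malliavin_density lambda <= (ell^-1)%:E)%E.
Proof.
move=> ell0 lambdaE /near_nondecreasing[N _ /(_ N (leqnn N)) psi_mono].
(* The maximum freezes q before N, where psi need not be monotone. *)
pose q k := (psi (maxn k N) - psi N) / ell.
have q0 k : 0 <= q k.
  by rewrite divr_ge0 ?(ltW ell0)// subr_ge0 psi_mono ?leq_maxr.
pose D := `|psi N| + ell.
have D0 : 0 <= D by rewrite addr_ge0// ltW.
have e20 : 0 < ell / 2 by rewrite divr_gt0.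
apply: (@beurling_malliavin_density_le_inv _ _ _ (ell / 2)
  (fun k => (k + Num.truncn (q k))%N)) => //.
- near=> k.
  have Nk : (N <= k)%N by near: k; exact: nbhs_infty_ge.
  have k0 : (0 < k)%N by near: k; exact: nbhs_infty_gt.
  rewrite lambdaE//; have := psi_mono N k (leqnn N) Nk.
  have : - psi N / (ell / 2) <= k%:R by near: k; exact: nbhs_infty_ger.
  rewrite ler_pdivrMr//; nra.
- move=> i j ij; rewrite -addSn leq_add// le_truncn// ler_pM2r ?invr_gt0// lerB//.
  by apply: psi_mono; rewrite ?leq_maxr// geq_max leq_maxr leq_max ltnW.
- by move=> k; exact: leq_addr.
apply: (@nneseries_lty_near_le _ (fun k => D * (k%:R ^+ 2)^-1)).
- by move=> k; rewrite mulr_ge0// invr_ge0 sqr_ge0.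
- by move=> k; rewrite divr_ge0// sqr_ge0.
- near=> k; rewrite /= ler_wpM2r ?invr_ge0 ?sqr_ge0//.
  have Nk : (N <= k)%N by near: k; exact: nbhs_infty_ge.
  have k0 : (0 < k)%N by near: k; exact: nbhs_infty_gt.
  have /andP[] := truncn_itv (q0 k).
  rewrite -natr1 natrD lambdaE// ler_pdivlMr// ltr_pdivrMr// (maxn_idPl Nk).
  set j : R := (Num.truncn _)%:R => jq qj.
  have -> : ell * k%:R + psi k - ell * (k%:R + j) = psi N + (psi k - psi N - j * ell).
    by ring.
  apply: le_trans (ler_normD _ _) _; rewrite lerD2l ger0_norm ?subr_ge0//.
  by move: qj; rewrite mulrDl mul1r; lra.
- by apply: nneseries_ltyZ => //; exact: nneseries_inv_sqr_lty.
Unshelve. all: by end_near. Qed.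

(** A value psi_n < - e * n propagates backwards: for n - eta * n <= k <= n,
lambda_k <= lambda_n gives psi_k <= psi_n + ell * (n - k) <= - e * n / 2 when
ell * eta <= e / 2.  The series then has about eta * n terms of size at least
(e / 2) / n, which is impossible for large n. *)
Lemma limn_einf_ratio_ge0_summable (R : realType) (lambda psi : R^nat) (ell : R) :
  ultimately_increasing lambda -> 0 < ell ->
  (forall n, (0 < n)%N -> lambda n = ell * n%:R + psi n) ->
  (\sum_(1 <= n <oo) (`|psi n| / n%:R ^+ 2)%:E < +oo)%E ->
  (0 <= limn_einf (fun n => (psi n / n%:R)%:E))%E.
Proof.
move=> lambda_incr ell0 lambdaE psi_sum; apply: limn_einf_ratio_ge0 => e e0.
have [N _ lambda_mono] := near_nondecreasing _ _ (ultimately_increasingW _ _ lambda_incr).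
(* eta <= 1/2 keeps the block [n - eta n, n] beyond N. *)
pose eta := Num.min (2^-1) (e / (2 * ell)).
have eta0 : 0 < eta by rewrite /eta lt_min invr_gt0 ltr0n/= divr_gt0// mulr_gt0.
have eta_half : eta <= 2^-1 by rewrite /eta ge_min lexx.
have eta_e : ell * eta <= e / 2.
  rewrite mulrC -ler_pdivlMr// -mulrA -invfM.
  by rewrite /eta ge_min lexx orbT.
have u0 k : 0 <= `|psi k| / k%:R ^+ 2 by rewrite divr_ge0// sqr_ge0.
near=> n.
have few : forall s : seq nat, uniq s ->
    (forall k, k \in s -> e / 2 / n%:R <= `|psi k| / k%:R ^+ 2) ->
    (size s)%:R < eta * n%:R.
  by near: n; apply: nneseries_few_large_terms => //; rewrite divr_gt0.
rewrite leNgt; apply/negP => psi_lt.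
have n0 : (0 < n)%N by near: n; exact: nbhs_infty_gt.
have n0R : 0 < n%:R :> R by rewrite ltr0n.
pose p := Num.truncn (eta * n%:R).
have eta_n0 : 0 <= eta * n%:R by rewrite mulr_ge0// ltW.
have p_le : p%:R <= eta * n%:R by rewrite truncn_le.
have p_gt : eta * n%:R < p.+1%:R by exact: truncnS_gt.
have pn : (p <= n)%N.
  by rewrite -(ler_nat R); apply: le_trans p_le _; move: eta_half; nra.
have Nnp : (N < n - p)%N.
  rewrite -(ltr_nat R) natrB//.
  have : 2 * N%:R + 1 <= n%:R :> R by near: n; exact: nbhs_infty_ger.
  by move: p_le eta_half n0R; nra.
have := few (iota (n - p) p.+1) (iota_uniq _ _); rewrite size_iota => few_block.
suff : p.+1%:R < eta * n%:R by move: p_gt; lra.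
apply: few_block => k; rewrite mem_iota addnS ltnS subnK// => /andP[npk kn].
have k0 : (0 < k)%N by apply: leq_trans npk; exact: leq_ltn_trans Nnp.
have k0R : 0 < k%:R :> R by rewrite ltr0n.
have npkR : n%:R - p%:R <= k%:R :> R by rewrite -natrB// ler_nat.
have knR : k%:R <= n%:R :> R by rewrite ler_nat.
have lambda_kn : lambda k <= lambda n.
  by apply: (lambda_mono N) => //=; apply: leq_trans npk; exact: ltnW.
have psi_k : e / 2 * n%:R <= - psi k.
  move: lambda_kn; rewrite !lambdaE//.
  have : ell * (n%:R - k%:R) <= e / 2 * n%:R.
    apply: le_trans (ler_wpM2r (ltW n0R) eta_e); rewrite -mulrA ler_wpM2l ?(ltW ell0)//.
    by move: p_le npkR; lra.
  by rewrite mulrBr; move: psi_lt; lra.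
rewrite ler_pdivlMr ?exprn_gt0//.
apply: (@le_trans _ _ (e / 2 * n%:R)); last by rewrite -normrN (le_trans psi_k)// ler_norm.
rewrite -(mulrA (e / 2)) ler_wpM2l//; first by rewrite ltW// divr_gt0.
by rewrite ler_pdivrMl// expr2 ler_pM.
Unshelve. all: by end_near. Qed.

Theorem proposition6p1 (R : realType) (lambda : R^nat) (ell : R) (psi : R^nat)
  (lambda_gt0 : forall n : nat, (0 < n)%N -> 0 < lambda n)
  (lambda_incr : ultimately_increasing lambda)
  (lambda_cvg : lambda n @[n --> \oo] --> +oo)
  (ell_gt0 : 0 < ell)
  (lambdaE : forall n : nat, (0 < n)%N -> lambda n = ell * n%:R + psi n)
  (psi_cond :
    ultimately_nondecreasing psi \/
    ((0 < limn_einf (fun n : nat => `|ell + psi n / n%:R|%:E))%E /\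
     (\sum_(1 <= n <oo) (`|psi n| / n%:R ^+ 2)%:E < +oo)%E)) :
  let alpha : \bar R := limn_einf (fun n : nat => (psi n / n%:R)%:E) in
  [/\ (beurling_malliavin_density lambda <= (ell^-1)%:E)%E,
      (0 <= alpha)%E &
      alpha = 0%E ->
      beurling_malliavin_density lambda = (ell^-1)%:E /\
      upper_asymptotic_density lambda = (ell^-1)%:E].
Proof.
move=> alpha.
have ratioE n : (0 < n)%N -> lambda n / n%:R = ell + psi n / n%:R.
  by move=> n0; rewrite lambdaE// mulrDl mulfK// pnatr_eq0 -lt0n.
have bm_le : (beurling_malliavin_density lambda <= (ell^-1)%:E)%E.
  case: psi_cond => [psi_mono|[kappa0 psi_sum]].
    exact: beurling_malliavin_density_le_inv_nondecreasing lambdaE psi_mono.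
  have [c c0 c_lt] : exists2 c : R, 0 < c &
      (c%:E < limn_einf (fun n : nat => `|ell + psi n / n%:R|%:E))%E.
    case: limn_einf kappa0 => [r| |]//; last by exists 1; rewrite ?ltry.
    by rewrite lte_fin => r0; exists (r / 2); rewrite ?lte_fin; lra.
  apply: (@beurling_malliavin_density_le_inv _ _ _ c id) => //.
    near=> k.
    have k0 : (0 < k)%N by near: k; exact: nbhs_infty_gt.
    have : (c%:E < `|ell + psi k / k%:R|%:E)%E.
      by near: k; exact: limn_einf_gt_near c_lt.
    rewrite lte_fin -ratioE// ger0_norm ?divr_ge0 ?(ltW (lambda_gt0 _ k0))//.
    by rewrite ltr_pdivlMr ?ltr0n// => /ltW.
  apply: nneseries_lty_near_le psi_sum => [k|k|].
  - by rewrite divr_ge0// sqr_ge0.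
  - by rewrite divr_ge0// sqr_ge0.
  near=> k; have k0 : (0 < k)%N by near: k; exact: nbhs_infty_gt.
  by rewrite /= lambdaE// addrAC subrr add0r.
split=> // [|alpha0].
  case: psi_cond => [/near_nondecreasing[N _ psi_mono]|[_ psi_sum]].
    apply: limn_einf_ratio_ge0 => e e0; near=> n.
    have : psi N <= psi n.
      by apply: (psi_mono N) => //=; near: n; exact: nbhs_infty_ge.
    have : - psi N / e <= n%:R by near: n; exact: nbhs_infty_ger.
    by rewrite ler_pdivrMr//; lra.
  exact: limn_einf_ratio_ge0_summable lambda_incr ell_gt0 lambdaE psi_sum.
have dens_ge : ((ell^-1)%:E <= upper_asymptotic_density lambda)%E.
  apply: inv_le_upper_asymptotic_density => //.
  apply/lee_addgt0Pr => e e0; rewrite leNgt; apply/negP => /limn_einf_gt_near h.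
  suff : (e%:E <= alpha)%E by rewrite alpha0 lee_fin leNgt e0.
  apply: near_limn_einf_ge; near=> n.
  have n0 : (0 < n)%N by near: n; exact: nbhs_infty_gt.
  have : (ell%:E + e%:E < (lambda n / n%:R)%:E)%E by near: n; exact: h.
  by rewrite ratioE// -EFinD lte_fin ltrD2l lee_fin => /ltW.
have dens_le := upper_asymptotic_density_le_beurling_malliavin _ _ lambda_gt0.
split; apply: le_anti; rewrite ?bm_le ?dens_ge ?andbT//=.
  exact: le_trans dens_ge dens_le.
exact: le_trans dens_le bm_le.
Unshelve. all: by end_near. Qed.
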